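(* Let $n\ge 3$ and let $\lambda=(\lambda_1,0,\dots,0)\in\mathbb{R}^n$ with $\lambda_1<2-n$. Then the Dirac inequality $$\|(\lambda-s)^++\rho\|^2\ge\|\lambda+\rho\|^2$$ holds for every Schmid module $s=s_{a,b}=(2b+a,a,0,\dots,0)$, where $a,b\ge 0$ are integers.
   Context: This is the case $\mathfrak{g}_0=\mathfrak{so}(2,2n-2)$. Here $\rho=(n-1,n-2,\dots,1,0)$ and $\|\cdot\|$ is the standard Euclidean norm on $\mathbb{R}^n$. The Weyl group $W_{\mathfrak{k}}$ is generated by the reflections in $\varepsilon_i\pm\varepsilon_j$, $2\le i<j\le n$, so it acts by permutations and even numbers of sign changes of the coordinates $2,\dots,n$ (fixing the first coordinate). For $\mu\in\mathbb{R}^n$, $\mu^+$ denotes the unique $W_{\mathfrak{k}}$-conjugate of $\mu$ satisfying $\mu_2\ge\mu_3\ge\dots\ge\mu_{n-1}\ge|\mu_n|$. Schmid modules are identified with the $n$-tuples $s_{a,b}=(2b+a,a,0,\dots,0)$ with integers $a,b\ge 0$. *)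

(* Defs.v *)
From HB Require Import structures.
From mathcomp Require Import all_boot all_order all_algebra all_fingroup.
From mathcomp Require Import ring lra zify.
From mathcomp Require Import boolp classical_sets reals.

Set Implicit Arguments.
Unset Strict Implicit.
Unset Printing Implicit Defensive.

Import Order.TTheory GRing.Theory Num.Theory.
Local Open Scope ring_scope.

(* The paper's 1-based coordinate x_(k+1) is x 0 i with i : 'I_n, i = k. *)

Section Definitions.
Variables (R : realType) (n : nat).
Implicit Types (x y alpha mu nu : 'rV[R]_n) (w : 'rV[R]_n -> 'rV[R]_n).

Definition dotv x y : R := \sum_(i < n) x 0 i * y 0 i.

Definition enorm x : R := Num.sqrt (dotv x x).

Definition eps (i : 'I_n) : 'rV[R]_n := delta_mx 0 i.

Definition reflection alpha x : 'rV[R]_n :=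
  x - (2 * dotv x alpha / dotv alpha alpha) *: alpha.

Definition k_root alpha : Prop :=
  exists i j : 'I_n, [/\ (1 <= i)%N, (i < j)%N
    & alpha = eps i + eps j \/ alpha = eps i - eps j].

(* Reflections are involutions, so the monoid they generate is the group. *)
Inductive Wk : ('rV[R]_n -> 'rV[R]_n) -> Prop :=
| Wk_id : Wk id
| Wk_reflection alpha w : k_root alpha -> Wk w -> Wk (reflection alpha \o w).

Definition Wk_conjugate mu nu : Prop := exists2 w, Wk w & nu = w mu.

Definition k_dominant mu : Prop :=
  (forall i j : 'I_n, (1 <= i)%N -> j = i.+1 :> nat -> (j.+1 < n)%N ->
     mu 0 j <= mu 0 i) /\
  (forall i j : 'I_n, (1 <= i)%N -> j = i.+1 :> nat -> j.+1 = n ->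
     `|mu 0 j| <= mu 0 i).

(* mu^+; the default value 0 is never used, see [dom_conjP]. *)
Definition dom_conj mu : 'rV[R]_n :=
  xget 0 [set nu | Wk_conjugate mu nu /\ k_dominant nu].

Definition rho : 'rV[R]_n := \row_(i < n) (n.-1 - i)%:R.

(* (c, 0, ..., 0) *)
Definition first_axis (c : R) : 'rV[R]_n :=
  \row_(i < n) (if i == 0%N :> nat then c else 0).

Definition schmid (a b : nat) : 'rV[R]_n :=
  \row_(i < n) (if i == 0%N :> nat then (2 * b + a)%:R
                else if i == 1%N :> nat then a%:R else 0).

End Definitions.

Arguments rho {R n}.
Arguments first_axis {R n} c.
Arguments schmid {R n} a b.

Section DominantConjugate.
Variables (R : realType) (n : nat).
Implicit Types (x y alpha mu nu : 'rV[R]_n) (i j : 'I_n).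

Let dotv_eps x i : dotv x (eps R i) = x 0 i.
Proof.
rewrite /dotv (bigD1 i) //= big1 ?addr0 ?mxE ?eqxx ?mulr1 // => k ki.
by rewrite mxE (negPf ki) andbF mulr0.
Qed.

Let dotvDr x y z : dotv x (y + z) = dotv x y + dotv x z.
Proof. by rewrite -big_split; apply: eq_bigr => k _; rewrite mxE mulrDr. Qed.

Let dotvNr x y : dotv x (- y) = - dotv x y.
Proof. by rewrite -sumrN; apply: eq_bigr => k _; rewrite mxE mulrN. Qed.

Let dotvC x y : dotv x y = dotv y x.
Proof. by apply: eq_bigr => k _; rewrite mulrC. Qed.

Let dotvZr x y c : dotv x (c *: y) = c * dotv x y.
Proof. by rewrite mulr_sumr; apply: eq_bigr => k _; rewrite mxE mulrCA. Qed.

Let reflD_E i j x k : i != j ->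
  reflection (eps R i + eps R j) x 0 k =
    (if (k == i) || (k == j) then - x 0 (tperm i j k) else x 0 (tperm i j k)).
Proof.
move=> ij; have ji : j != i by rewrite eq_sym.
rewrite /reflection !dotvDr !dotv_eps !mxE !eqxx /= (negPf ij) (negPf ji).
case: tpermP => [->|->|/eqP/negPf ki /eqP/negPf kj].
- by rewrite !eqxx (negPf ij) /=; field.
- by rewrite !eqxx (negPf ji) /=; field.
- by rewrite ki kj /= !mulr0n; ring.
Qed.

Let reflB_E i j x k : i != j ->
  reflection (eps R i - eps R j) x 0 k = x 0 (tperm i j k).
Proof.
move=> ij; have ji : j != i by rewrite eq_sym.
rewrite /reflection !dotvDr !dotvNr !dotv_eps !mxE !eqxx /= (negPf ij) (negPf ji).
case: tpermP => [->|->|/eqP/negPf ki /eqP/negPf kj].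
- by rewrite !eqxx (negPf ij) /=; field.
- by rewrite !eqxx (negPf ji) /=; field.
- by rewrite ki kj /= !mulr0n; ring.
Qed.

Let act (se : 'S_n * {ffun 'I_n -> bool}) x : 'rV[R]_n :=
  \row_k ((-1) ^+ se.2 k * x 0 (se.1 k)).

Let act1 : act (1%g, [ffun=> false]) = id.
Proof.
by apply/funext => x; apply/rowP => k; rewrite mxE /= ffunE perm1 mul1r.
Qed.

Let refl_act alpha se : k_root alpha ->
  exists se', reflection alpha \o act se = act se'.
Proof.
case=> i [j [_ ij ae]]; have nij : i != j by rewrite neq_ltn ij.
case: ae => ->.
- exists ((tperm i j * se.1)%g,
    [ffun k => ((k == i) || (k == j)) (+) se.2 (tperm i j k)]).
  apply/funext => x; apply/rowP => k; rewrite /= reflD_E // !mxE /= ffunE permM.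
  by case: ifP => _; rewrite ?signr_addb ?expr1 ?expr0 ?mul1r ?mulN1r ?mulNr.
- exists ((tperm i j * se.1)%g, [ffun k => se.2 (tperm i j k)]).
  by apply/funext => x; apply/rowP => k; rewrite /= reflB_E // !mxE /= ffunE permM.
Qed.

Let root_norm i j alpha : (i < j)%N ->
  alpha = eps R i + eps R j \/ alpha = eps R i - eps R j ->
  0 < dotv alpha alpha.
Proof.
move=> ij; have /negPf nij : i != j by rewrite neq_ltn ij.
have /negPf nji : j != i by rewrite eq_sym nij.
by case=> ->; rewrite !dotvDr ?dotvNr !dotv_eps !mxE !eqxx nij nji ?eqxx /= ?mulr0n ?mulr1n; lra.
Qed.

Let reflection_rho alpha nu : 0 < dotv alpha alpha -> 0 < dotv alpha rho ->
  dotv (reflection alpha nu) rho <= dotv nu rho -> 0 <= dotv nu alpha.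
Proof.
move=> aa ar; rewrite dotvC /reflection dotvDr dotvNr dotvZr -(dotvC nu).
rewrite gerBl (dotvC rho) pmulr_lge0 // pmulr_lge0 ?invr_gt0 //.
by rewrite pmulr_rge0.
Qed.

Lemma dom_conj_exists mu :
  exists nu, Wk_conjugate mu nu /\ k_dominant nu.
Proof.
pose P se := `[< Wk (act se) >].
have P1 : P (1%g, [ffun=> false]) by apply/asboolP; rewrite act1; exact: Wk_id.
case: (Order.TotalTheory.arg_maxP (fun se => dotv (act se mu) rho) P1).
move=> se /asboolP Pse se_max.
have key alpha : k_root alpha -> 0 < dotv alpha alpha -> 0 < dotv alpha rho ->
    0 <= dotv (act se mu) alpha.
  move=> ka aa ar; apply: reflection_rho => //.
  have [se' e] := refl_act se ka.
  have /se_max : P se' by apply/asboolP; rewrite -e; exact: Wk_reflection.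
  by rewrite -e.
have sub i j : (1 <= i)%N -> j = i.+1 :> nat ->
    act se mu 0 j <= act se mu 0 i.
  move=> i1 ji; have ij : (i < j)%N by rewrite ji.
  rewrite -subr_ge0 -!dotv_eps -dotvNr -dotvDr; apply: key.
  - by exists i, j; split=> //; right.
  - exact: root_norm (or_intror erefl).
  - rewrite dotvC dotvDr dotvNr !dotv_eps !mxE subr_gt0 ltr_nat.
    by move: (ltn_ord j) ij; clear; lia.
have add i j : (1 <= i)%N -> j = i.+1 :> nat ->
    - act se mu 0 j <= act se mu 0 i.
  move=> i1 ji; have ij : (i < j)%N by rewrite ji.
  rewrite -subr_ge0 opprK -!dotv_eps -dotvDr; apply: key.
  - by exists i, j; split=> //; left.
  - exact: root_norm (or_introl erefl).
  - rewrite dotvC dotvDr !dotv_eps !mxE ltr_pwDl //.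
    by rewrite ltr0n; move: (ltn_ord j) ij; clear; lia.
exists (act se mu); split; first by exists (act se).
split=> i j i1 ji _; first exact: sub.
by rewrite ler_norml lerNl add // sub.
Qed.


Let Wk_invariants w mu : Wk w ->
  [/\ forall i, i = 0%N :> nat -> w mu 0 i = mu 0 i,
      exists p : 'S_n, (forall i, (0 < p i)%N = (0 < i)%N) /\
        (forall i, w mu 0 i ^+ 2 = mu 0 (p i) ^+ 2)
    & \prod_(i < n | (0 < i)%N) w mu 0 i = \prod_(i < n | (0 < i)%N) mu 0 i].
Proof.
elim=> {w} [|alpha w [i [j [i1 ij ae]]] _ [IH0 [p [p0 psq]] IHp]].
  by split=> //; exists 1%g; split=> i; rewrite perm1.
have nij : i != j by rewrite neq_ltn ij.
have j1 : (0 < j)%N by exact: leq_trans ij.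
have tpos k : (0 < tperm i j k)%N = (0 < k)%N.
  by case: tpermP => [->|->|//]; rewrite ?j1 ?i1.
have t0 (k : 'I_n) : k = 0%N :> nat -> tperm i j k = k.
  by case: tpermP => // -> k0; [move: i1 | move: j1]; rewrite k0.
have tprod (x : 'rV[R]_n) : \prod_(k < n | (0 < k)%N) x 0 (tperm i j k) =
    \prod_(k < n | (0 < k)%N) x 0 k.
  rewrite [RHS](reindex_inj (@perm_inj _ (tperm i j))) /=.
  by apply: eq_bigl => k; rewrite tpos.
split; last 1 first.
- rewrite -IHp; case: ae => -> /=; last first.
    by under eq_bigr do rewrite reflB_E //; rewrite tprod.
  rewrite -(tprod (w mu)) (bigD1 i) // (bigD1 j) /= ?j1 1?eq_sym //.
  rewrite [RHS](bigD1 i) // [in RHS](bigD1 j) /= ?j1 1?eq_sym //.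
  rewrite !reflD_E // !eqxx orbT /= !mulNr mulrN opprK.
  congr (_ * (_ * _)); apply: eq_bigr => k /andP[/andP[_ ki] kj].
  by rewrite reflD_E // (negPf ki) (negPf kj).
- move=> k k0; rewrite -IH0 //; case: ae => -> /=.
    rewrite reflD_E // t0 //; case: eqP => [ki|_]; first by rewrite -ki k0 in i1.
    by case: eqP => [kj|//]; rewrite -kj k0 in j1.
  by rewrite reflB_E // t0.
- exists (tperm i j * p)%g; split=> k; rewrite permM; first by rewrite p0 tpos.
  rewrite -psq; case: ae => -> /=; last by rewrite reflB_E.
  by rewrite reflD_E //; case: ifP => _; rewrite ?sqrrN.
Qed.

Let dominant_le nu i j : k_dominant nu -> (0 < i)%N -> (i < j)%N ->
  `|nu 0 j| <= nu 0 i.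
Proof.
case=> mid lst; move: {2}(n - i)%N (leqnn (n - i)) => d.
elim: d i j => [|d IH] i j; first by rewrite leqn0 subn_eq0 leqNgt ltn_ord.
move=> dn i1 ij; have i'n : (i.+1 < n)%N by exact: leq_ltn_trans (ltn_ord j).
pose i' := Ordinal i'n.
have [nE|i''n] : i'.+1 = n \/ (i'.+1 < n)%N.
  by have := i'n; rewrite leq_eqVlt => /orP[/eqP|]; [left|right].
  by apply: lst => //; move: nE ij (ltn_ord j) => /=; clear; lia.
have IH' (k : 'I_n) : (i.+1 < k)%N -> `|nu 0 k| <= nu 0 i'.
  by apply: (IH i') => //=; move: dn (ltn_ord i); clear; lia.
have le1 : nu 0 i' <= nu 0 i by exact: mid.
move: ij; rewrite leq_eqVlt => /orP[/eqP ji|/IH' /le_trans]; last exact.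
have -> : j = i' by apply/val_inj.
by rewrite ger0_norm // (le_trans _ (IH' (Ordinal i''n) _)) //=.
Qed.

Lemma dom_conj_unique mu nu nu' :
  Wk_conjugate mu nu -> k_dominant nu ->
  Wk_conjugate mu nu' -> k_dominant nu' -> nu = nu'.
Proof.
case=> w Ww nuE dnu [w' Ww' nu'E] dnu'.
pose s := [seq i <- enum 'I_n | (0 < (i : 'I_n))%N].
have mem_s i : (i \in s) = (0 < i)%N by rewrite mem_filter mem_enum andbT.
pose sq (x : 'rV[R]_n) := [seq x 0 i ^+ 2 | i <- s].
have perm_sq v : Wk v -> perm_eq (sq (v mu)) (sq mu).
  move=> /(Wk_invariants mu)[_ [p [p0 psq]] _].
  have -> : sq (v mu) = [seq mu 0 i ^+ 2 | i <- map p s].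
    by rewrite -map_comp; apply: eq_map => i; rewrite psq.
  have pI := @perm_inj _ p.
  have s_uniq : uniq s by apply: filter_uniq; exact: enum_uniq.
  apply/perm_map/uniq_perm; rewrite ?(map_inj_uniq pI) //.
  move=> i; rewrite mem_s -[i in LHS](permKV p) (mem_map pI) mem_s.
  by rewrite -p0 permKV.
have sorted_sq x : k_dominant x -> sorted >=%O (sq x).
  move=> dx; rewrite sorted_map.
  have : sorted (fun i j : 'I_n => (i < j)%N) s.
    apply: sorted_filter => [? ? ?|]; first exact: ltn_trans.
    by have := iota_ltn_sorted 0 n; rewrite -val_enum_ord sorted_map.
  apply: (@sub_in_sorted _ [in s]); last exact/allP.
  move=> i j; rewrite !mem_s => i1 _ ij /=.
  have le1 := dominant_le dx i1 ij.
  by rewrite -[leLHS]real_normK ?num_real // ler_sqr ?nnegrE // (le_trans _ le1).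
have sqE i : (0 < i)%N -> nu 0 i ^+ 2 = nu' 0 i ^+ 2.
  rewrite -mem_s; move: i; apply/eq_in_map; rewrite -/(sq nu) -/(sq nu').
  apply: (sorted_eq ge_trans ge_anti); [exact: sorted_sq.. |].
  by rewrite nuE nu'E (perm_trans (perm_sq w Ww)) // perm_sym perm_sq.
have [w0 _ wp] := Wk_invariants mu Ww; have [w'0 _ w'p] := Wk_invariants mu Ww'.
have mid i j : (0 < i)%N -> (i < j)%N -> nu 0 i = nu' 0 i.
  move=> i1 ij; apply/eqP; rewrite -(@eqrXn2 _ 2) ?sqE //.
    exact: le_trans (dominant_le dnu i1 ij).
  exact: le_trans (dominant_le dnu' i1 ij).
apply/rowP => i; have [i0|i1] := posnP i; first by rewrite nuE nu'E w0 ?w'0.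
have [ilt|nE] : (i.+1 < n)%N \/ i.+1 = n.
  by have := ltn_ord i; rewrite leq_eqVlt => /orP[/eqP|]; [right|left].
  exact: (mid i (Ordinal ilt)).
have lt_last k : k != i -> (k < i)%N.
  by move=> ki; rewrite ltn_neqAle ki -ltnS nE ltn_ord.
have /eqP : nu 0 i ^+ 2 = nu' 0 i ^+ 2 by exact: sqE.
rewrite eqf_sqr => /orP[/eqP//|/eqP nuN].
have : \prod_(k < n | (0 < k)%N) nu 0 k = \prod_(k < n | (0 < k)%N) nu' 0 k.
  by rewrite nuE nu'E wp w'p.
rewrite (bigD1 i) // [RHS](bigD1 i) //=.
under eq_bigr => k /andP[k1 ki] do rewrite (mid k i k1 (lt_last k ki)).
set P := \prod_(_ < _ | _) _; have [P0 _|P0 /(mulIf P0)//] := eqVneq P 0.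
have /prodf_eq0[k /andP[k1 ki] /eqP k0] : P == 0 by exact/eqP.
have := dominant_le dnu' k1 (lt_last k ki).
by rewrite k0 normr_le0 nuN => /eqP ->; rewrite oppr0.
Qed.

Lemma dom_conjP mu :
  [/\ Wk_conjugate mu (dom_conj mu), k_dominant (dom_conj mu)
    & forall nu, Wk_conjugate mu nu -> k_dominant nu -> nu = dom_conj mu].
Proof.
have [] := xgetPex 0 (dom_conj_exists mu); rewrite -/(dom_conj mu) => c d.
by split=> // nu cnu dnu; exact: dom_conj_unique c d.
Qed.

End DominantConjugate.

(* Main.v *)
Require Import Defs.
From mathcomp Require Import all_boot all_order all_algebra.
From mathcomp Require Import ring lra zify.
From mathcomp Require Import reals.

Import Order.TTheory GRing.Theory Num.Theory.
Local Open Scope ring_scope.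

(** Changing the signs of two coordinates other than the first is an element
    of the Weyl group.  Only the second coordinate [- a] of [lambda - s] has
    the wrong sign, and since [n >= 3] there is a zero coordinate after it to
    absorb the second sign change; hence
      [(lambda - s)^+ = (lambda1 - m, a, 0, ..., 0)] with [m = 2 b + a]
    ([dom_conj_sub_schmid]).  After adding [rho] this vector differs from
    [lambda + rho] in the first two coordinates only, so the Dirac inequality
    says that
      [m ^ 2 - 2 m (lambda1 + n - 1) + a ^ 2 + 2 a (n - 2)]
    is nonnegative.  The hypothesis on [lambda1] says that
    [lambda1 + n - 1 < 1], and [n - 2 >= 1], so this is at least
      [m ^ 2 - 2 m + a ^ 2 + 2 a = 4 b (b - 1) + 4 a b + 2 a ^ 2],
    which is nonnegative because [b] is a natural number. *)

Lemma dotv_eps (R : realType) (n : nat) (x : 'rV[R]_n) (i : 'I_n) :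
  dotv x (eps R i) = x 0 i.
Proof.
rewrite /dotv (bigD1 i) //= big1 ?addr0 ?mxE ?eqxx ?mulr1 // => k ki.
by rewrite mxE (negPf ki) andbF mulr0.
Qed.

Lemma dotvD (R : realType) (n : nat) (x y z : 'rV[R]_n) :
  dotv x (y + z) = dotv x y + dotv x z.
Proof. by rewrite -big_split; apply: eq_bigr => k _; rewrite mxE mulrDr. Qed.

Lemma dotvB (R : realType) (n : nat) (x y z : 'rV[R]_n) :
  dotv x (y - z) = dotv x y - dotv x z.
Proof.
by rewrite dotvD -sumrN; congr (_ + _); apply: eq_bigr => k _; rewrite mxE mulrN.
Qed.

Lemma sqr_enorm (R : realType) (n : nat) (x : 'rV[R]_n) :
  enorm x ^+ 2 = dotv x x.
Proof. by apply: sqr_sqrtr; apply: sumr_ge0 => i _; exact: sqr_ge0. Qed.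

(** The two roots are orthogonal and span the same plane as [eps i] and
    [eps j], so the product of their reflections is [-1] on this plane. *)
Lemma reflection_sign_change (R : realType) (n : nat) (i j : 'I_n)
    (x : 'rV[R]_n) : i != j ->
  reflection (eps R i - eps R j) (reflection (eps R i + eps R j) x) =
  \row_k (if (k == i) || (k == j) then - x 0 k else x 0 k).
Proof.
move=> ij; have ji : j != i by rewrite eq_sym.
apply/rowP => k; rewrite /reflection !dotvB !dotvD !dotv_eps !mxE !eqxx /=.
rewrite (negPf ij) (negPf ji).
have [->|ki] := eqVneq k i; first by rewrite (negPf ij) /=; field.
have [->|kj] /= := eqVneq k j; first by field.
by rewrite !mulr0n; ring.
Qed.

Lemma Wk_conjugate_sign_change (R : realType) (n : nat) (i j : 'I_n)
    (x : 'rV[R]_n) : (1 <= i)%N -> (i < j)%N ->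
  Wk_conjugate x (\row_k (if (k == i) || (k == j) then - x 0 k else x 0 k)).
Proof.
move=> i1 ij; have nij : i != j by rewrite neq_ltn ij.
exists (reflection (eps R i - eps R j) \o (reflection (eps R i + eps R j) \o id));
  last by rewrite /= reflection_sign_change.
apply: Wk_reflection; first by exists i, j; split=> //; right.
apply: Wk_reflection; first by exists i, j; split=> //; left.
exact: Wk_id.
Qed.

Lemma dom_conj_sub_schmid (R : realType) (n : nat) (c : R) (a b : nat) :
  (3 <= n)%N ->
  dom_conj (first_axis c - schmid a b) =
  \row_(i < n) (if i == 0%N :> nat then c - (2 * b + a)%:R
                else if i == 1%N :> nat then a%:R else 0).
Proof.
move=> n3.
have [_ _ uniq_dom] := dom_conjP (first_axis c - @schmid R n a b).
apply/esym/uniq_dom.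
  pose i1 : 'I_n := Ordinal (ltn_trans (isT : 1 < 2)%N n3).
  pose i2 : 'I_n := Ordinal n3.
  have := @Wk_conjugate_sign_change R n i1 i2 (first_axis c - schmid a b) isT isT.
  congr (Wk_conjugate _ _); apply/rowP => k; rewrite !mxE -!val_eqE /=.
  by case: (val k) => [|[|[|k']]] //=; rewrite ?sub0r ?opprK ?subr0 ?oppr0.
split=> i j i1 ji jn; rewrite !mxE.
  have -> : (j == 0%N :> nat) = false by lia.
  have -> : (j == 1%N :> nat) = false by lia.
  have -> : (i == 0%N :> nat) = false by lia.
  by case: ifP.
have -> : (j == 0%N :> nat) = false by lia.
have -> : (j == 1%N :> nat) = false by lia.
have -> : (i == 0%N :> nat) = false by lia.
by rewrite normr0; case: ifP.
Qed.

Lemma dirac_polynomial_ge0 (R : realType) (a b : nat) (x y : R) :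
  x < 1 -> 1 <= y ->
  0 <= (2 * b + a)%:R ^+ 2 - 2 * (2 * b + a)%:R * x + a%:R ^+ 2 + 2 * a%:R * y.
Proof.
move=> x1 y1; rewrite natrD natrM.
have a0 : 0 <= a%:R :> R by [].
have b0 : 0 <= b%:R :> R by [].
have bb : 0 <= b%:R * (b%:R - 1) :> R.
  by case: b {b0} => [|b]; rewrite ?mul0r // mulr_ge0 // subr_ge0 ler1n.
have ab : 0 <= a%:R * b%:R :> R by exact: mulr_ge0.
have mx : 0 <= (2 * b%:R + a%:R) * (1 - x).
  by apply: mulr_ge0; [lra | rewrite subr_ge0 ltW].
have ay : 0 <= a%:R * (y - 1) by rewrite mulr_ge0 // subr_ge0.
have aa : 0 <= a%:R ^+ 2 :> R by exact: sqr_ge0.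
lra.
Qed.

Theorem theorem3p78 (R : realType) (n : nat) (lambda1 : R) :
  (3 <= n)%N ->
  lambda1 < 2 - n%:R ->
  let lambda : 'rV[R]_n := first_axis lambda1 in
  forall a b : nat,
    enorm (dom_conj (lambda - schmid a b) + rho) ^+ 2
      >= enorm (lambda + rho) ^+ 2.
Proof.
move=> n3 lt_lambda1 lambda a b.
rewrite {}/lambda dom_conj_sub_schmid // !sqr_enorm /dotv.
case: n n3 lt_lambda1 => [|[|[|m]]] // _ lt_lambda1.
(* Separate the first two coordinates; the others are those of [rho] on both
   sides. *)
rewrite !big_ord_recl !mxE /= !subn0 !add0r.
set tail := (X in _ <= _ + (_ + (_ + X))).
set tail' := (X in _ + (_ + (_ + X)) <= _).
have -> : tail' = tail by apply: eq_bigr => i _; rewrite !mxE.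
have := @dirac_polynomial_ge0 R a b (lambda1 + m.+2%:R) m.+1%:R.
rewrite subSS subn0 ler1n => /(_ _ isT) poly_ge0.
have {}/poly_ge0 : lambda1 + m.+2%:R < 1.
  by move: lt_lambda1; rewrite (mulrSr _ m.+2); lra.
lra.
Qed.
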